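(* Let $q$ be a prime power and let $\mathcal{C}$ be an $[n,k]$ linear code over $\mathbb{F}_q$ with minimum distance $d$, diameter $\delta$ and $d(\mathcal{C}^\perp)\ge 2$. Then $$n \le d + \frac{q\bigl(1-q^{-(k-1)}\bigr)}{q-1}\,\delta.$$ Equivalently, $$n \le d + \left\lfloor \sum_{i=0}^{k-2}\frac{\delta}{q^i}\right\rfloor.$$
   Context: An $[n,k]$ linear code over $\mathbb{F}_q$ (with $n$ a positive integer) is a $k$-dimensional $\mathbb{F}_q$-subspace $\mathcal{C}$ of $\mathbb{F}_q^n$. The Hamming weight $\mathrm{wt}(\mathbf{c})$ is the number of nonzero coordinates of $\mathbf{c}$. The minimum distance $d=d(\mathcal{C})$ is the minimum weight of a nonzero codeword. The diameter of $\mathcal{C}$ is its maximum weight, $\delta=\delta(\mathcal{C})=\max\{\mathrm{wt}(\mathbf{c}) : \mathbf{c}\in\mathcal{C}\}$. The dual code is $\mathcal{C}^\perp=\{\mathbf{x}\in\mathbb{F}_q^n : \sum_{i}x_ic_i=0 \text{ for all } \mathbf{c}\in\mathcal{C}\}$. The condition $d(\mathcal{C}^\perp)\ge 2$ means that $\mathcal{C}^\perp$ contains no vector of weight $1$; equivalently, a generator matrix of $\mathcal{C}$ (a $k\times n$ matrix whose rows form a basis of $\mathcal{C}$) has no zero column. An empty sum (when $k=1$) is $0$. *)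

(* Defs.v *)
From HB Require Import structures.
From mathcomp Require Import all_boot all_order all_algebra all_field.

Set Implicit Arguments.
Unset Strict Implicit.
Unset Printing Implicit Defensive.

Import GRing.Theory.
Local Open Scope ring_scope.

Definition hamming_weight (F : finFieldType) (n : nat) (c : 'rV[F]_n) : nat :=
  #|[set i : 'I_n | c 0 i != 0]|.

(* The default value n.+1 is returned exactly when S has no nonzero vector
   (every weight is at most n); it stands for the infinite minimum distance of
   the zero code, see [min_distance_gt1P]. *)
Definition min_distance (F : finFieldType) (n : nat) (S : {set 'rV[F]_n}) : nat :=
  \big[minn/n.+1]_(c in S | c != 0) hamming_weight c.

Definition diameter (F : finFieldType) (n : nat) (S : {set 'rV[F]_n}) : nat :=
  (\max_(c in S) hamming_weight c)%N.

Definition codewords (F : finFieldType) (n : nat) (C : {vspace 'rV[F]_n}) :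
  {set 'rV[F]_n} := [set c | c \in C].

Definition dual_code (F : finFieldType) (n : nat) (S : {set 'rV[F]_n}) :
  {set 'rV[F]_n} :=
  [set x : 'rV[F]_n | [forall c in S, \sum_(i < n) x 0 i * c 0 i == 0]].

Lemma hamming_weight_le (F : finFieldType) n (c : 'rV[F]_n) :
  (hamming_weight c <= n)%N.
Proof. by rewrite -[leqRHS]card_ord max_card. Qed.

Lemma hamming_weight_eq0 (F : finFieldType) n (c : 'rV[F]_n) :
  (hamming_weight c == 0%N) = (c == 0).
Proof.
rewrite cards_eq0; apply/eqP/eqP => [c0|->]; last first.
  by apply/setP => i; rewrite !inE mxE eqxx.
apply/rowP => i; move/setP/(_ i): c0.
by rewrite !inE mxE => /negbFE/eqP.
Qed.

Lemma leq_min_distanceP (F : finFieldType) n m (S : {set 'rV[F]_n}) :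
  reflect ((m <= n.+1)%N /\
           forall c, c \in S -> c != 0 -> (m <= hamming_weight c)%N)
          (m <= min_distance S)%N.
Proof.
have -> : (m <= min_distance S)%N =
    (m <= n.+1)%N && [forall (c | (c \in S) && (c != 0)), (m <= hamming_weight c)%N].
  rewrite -big_andE /min_distance.
  elim/big_rec2: _ => [|c b d _ IH]; first by rewrite andbT.
  by rewrite leq_min IH andbCA.
apply: (iffP andP) => -[-> h]; split=> //.
  by move=> c cS c0; move/forall_inP: h; apply; rewrite cS.
by apply/forall_inP => c /andP[]; apply: h.
Qed.

Lemma min_distance_attained (F : finFieldType) n (S : {set 'rV[F]_n}) c0 :
  c0 \in S -> c0 != 0 ->
  exists c, [/\ c \in S, c != 0 & hamming_weight c = min_distance S].
Proof.
move=> c0S c0n0.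
have c0P : (c0 \in S) && (c0 != 0) by rewrite c0S.
case: (@arg_minnP _ c0 [pred c | (c \in S) && (c != 0)]
        (@hamming_weight F n) c0P) => c /andP[cS cn0] cmin.
exists c; split=> //; apply/eqP; rewrite eqn_leq; apply/andP; split.
  apply/leq_min_distanceP; split; first exact: leqW (hamming_weight_le c).
  by move=> x xS x0; apply: cmin; rewrite /= xS.
by have /leq_min_distanceP[_] := leqnn (min_distance S); apply.
Qed.

Lemma min_distance_gt1P (F : finFieldType) n (S : {set 'rV[F]_n}) :
  (0 < n)%N ->
  (1 < min_distance S)%N <-> (forall x, x \in S -> hamming_weight x <> 1%N).
Proof.
move=> n0; split=> [/leq_min_distanceP[_ h] x xS wx|h].
  have x0 : x != 0 by rewrite -hamming_weight_eq0 wx.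
  by have := h x xS x0; rewrite wx.
apply/leq_min_distanceP; split=> // c cS c0.
have := h c cS; rewrite -hamming_weight_eq0 in c0.
by case: (hamming_weight c) c0 => [|[|]].
Qed.

(* Main.v *)
Require Import Defs.
From HB Require Import structures.
From mathcomp Require Import all_boot all_order all_algebra all_field.
From mathcomp Require Import ring.

(* Let c be a word of minimum weight d and count the nonzero entries of all the
   words of C on the n - d coordinates outside the support of c.  No coordinate
   vanishes identically on C, so each one is nonzero on q^k - q^(k-1) words.
   Conversely the q multiples of c contribute nothing and every other word at
   most delta, whence (n - d) (q^k - q^(k-1)) <= (q^k - q) delta. *)

Set Implicit Arguments.
Unset Strict Implicit.
Unset Printing Implicit Defensive.

Import Order.TTheory GRing.Theory Num.Theory.
Local Open Scope ring_scope.

Lemma card_codewords (F : finFieldType) n (C : {vspace 'rV[F]_n}) :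
  #|codewords C| = (#|F| ^ \dim C)%N.
Proof. by rewrite cardsE card_vspace. Qed.

(** If every codeword vanished at [i], the unit vector [delta_mx 0 i] would be a dual word of weight
    1; otherwise a codeword nonzero at [i] can be rescaled. *)
Lemma dual_gt1_coord (F : finFieldType) n (C : {vspace 'rV[F]_n}) (i : 'I_n) :
  (2 <= min_distance (dual_code (codewords C)))%N ->
  exists2 g, g \in C & g 0 i = 1.
Proof.
have n_gt0 : (0 < n)%N by case: (n) i => [[]|].
move=> /(min_distance_gt1P _ n_gt0) /(_ (delta_mx 0 i)) noweight1.
have [/exists_inP[c cC ci]|/exists_inPn C0] :=
  boolP [exists c in codewords C, c 0 i != 0].
  exists ((c 0 i)^-1 *: c); last by rewrite mxE mulVf.
  by rewrite memvZ //; rewrite inE in cC.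
case: noweight1.
  rewrite inE; apply/forall_inP => c /C0 /negPn/eqP ci.
  rewrite big1 // => j _; rewrite mxE eqxx /=.
  by have [->|] := eqVneq j i; rewrite ?ci ?mulr0 ?mul0r.
rewrite /hamming_weight (_ : [set _ | _] = [set i]) ?cards1 //.
by apply/setP => j; rewrite !inE mxE eqxx /=; case: (j == i); rewrite ?oner_eq0 ?eqxx.
Qed.

(* The fibres of the i-th coordinate on C are translates of one another by
   multiples of g. *)
Lemma card_coord_neq0 (F : finFieldType) n (C : {vspace 'rV[F]_n}) (i : 'I_n) g :
  g \in C -> g 0 i = 1 ->
  (#|F| * #|[set c in codewords C | c 0%R i != 0%R]| =
   (#|F| - 1) * #|codewords C|)%N.
Proof.
move=> gC gi; pose fibre a := [set c in codewords C | c 0 i == a].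
have fibreE a : #|fibre a| = #|fibre 0|.
  rewrite -(card_imset (fibre 0) (addIr (a *: g))); apply: eq_card => c.
  apply/idP/imsetP => [|[x]]; rewrite !inE => /andP[cC /eqP ci].
    exists (c - a *: g); last by rewrite subrK.
    by rewrite !inE !mxE ci gi mulr1 subrr eqxx andbT memvB ?memvZ.
  by move=> ->; rewrite !mxE ci gi add0r mulr1 eqxx andbT memvD ?memvZ.
have cardC : #|codewords C| = (#|F| * #|fibre 0%R|)%N.
  rewrite -sum1_card (partition_big (fun c : 'rV[F]_n => c 0 i) predT) //=.
  rewrite -sum_nat_const; apply: eq_bigr => a _.
  by rewrite -(fibreE a) -sum1_card; apply: eq_bigl => c; rewrite !inE.
have split0 : (#|fibre 0%R| + #|[set c in codewords C | c 0%R i != 0%R]| =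
    #|codewords C|)%N.
  rewrite -(cardsID [set c : 'rV[F]_n | c 0 i == 0] (codewords C)); congr (_ + _)%N.
    by apply: eq_card => c; rewrite !inE.
  by apply: eq_card => c; rewrite !inE andbC.
(* With N the size of [fibre 0], both sides equal q (q - 1) N. *)
rewrite -(addKn #|fibre 0| #|[set _ in _ | _]|) split0 cardC mulnBl mul1n.
by rewrite mulnBr.
Qed.

(** Double counting as above. The extra factor [#|F|] on both sides avoids the exponent k - 1, since
    q (q^k - q^(k-1)) = (q - 1) q^k. *)
Lemma length_sub_weight_le (F : finFieldType) n (C : {vspace 'rV[F]_n}) c :
  (2 <= min_distance (dual_code (codewords C)))%N -> c \in C -> c != 0 ->
  ((n - hamming_weight c) * ((#|F| - 1) * #|F| ^ \dim C) <=
   #|F| * ((#|F| ^ \dim C - #|F|) * diameter (codewords C)))%N.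
Proof.
move=> hdual cC c0; pose Z := [set i | c 0 i == 0].
have -> : (n - hamming_weight c = #|Z|)%N.
  rewrite -[RHS](addnK #|~: Z|) cardsC card_ord; congr subn.
  by apply: eq_card => i; rewrite !inE.
pose wZ (x : 'rV[F]_n) := #|[set i in Z | x 0 i != 0]|.
(* Exchanging the sums over words and over coordinates in [Z] leaves the count of words nonzero at
   each [i] in [Z]. *)
have sum_wZ : (#|F| * \sum_(x in codewords C) wZ x =
    #|Z| * ((#|F| - 1) * #|F| ^ \dim C))%N.
  transitivity (#|F| * \sum_(i in Z) #|[set x in codewords C | x 0%R i != 0%R]|)%N.
    congr muln; under eq_bigr do rewrite /wZ cardsE -sum1_card big_mkcondr /=.
    rewrite exchange_big; apply: eq_bigr => i _.
    by rewrite cardsE -sum1_card big_mkcondr.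
  rewrite big_distrr -sum_nat_const; apply: eq_bigr => i _ /=.
  have [g gC gi] := dual_gt1_coord i hdual.
  by rewrite (card_coord_neq0 gC gi) card_codewords.
rewrite -sum_wZ leq_mul2l; apply/orP; right.
have lineC : codewords <[c]>%VS \subset codewords C.
  by apply/subsetP => x; rewrite !inE => /vlineP[a ->]; rewrite memvZ.
have cardline : #|codewords <[c]>%VS| = #|F|.
  by rewrite card_codewords dim_vline c0 expn1.
(* The factor q^k - q becomes the number of codewords off the line of [c], the only ones with a
   nonzero contribution on [Z]. *)
rewrite -[X in (_ - X)%N]cardline -card_codewords.
rewrite -[X in (_ <= (_ - #|pred_of_set X|) * _)%N](setIidPr lineC) -cardsD.
rewrite (big_setID (codewords <[c]>%VS)) /= big1 ?add0n; last first.
  move=> x; rewrite !inE => /andP[_ /vlineP[a ->]]; apply/eqP.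
  rewrite cards_eq0; apply/eqP/setP => i; rewrite !inE mxE.
  by case: eqP => // ->; rewrite mulr0 eqxx.
rewrite -sum_nat_const; apply: leq_sum => x /setDP[xC _].
apply: (@leq_trans (hamming_weight x)).
  by apply: subset_leq_card; apply/subsetP => i; rewrite !inE => /andP[].
by rewrite /diameter (bigD1 x) //= leq_maxl.
Qed.

(** Links the two forms of the bound, with [x] = q, [a] = delta and [m] = k - 1; for k = 1 both
    sides are 0. *)
Lemma geometric_sumV (R : fieldType) (x a : R) m : x != 0 -> x != 1 ->
  \sum_(0 <= i < m) a / x ^+ i = x * (1 - x ^- m) / (x - 1) * a.
Proof.
move=> x0 x1; have x10 : x - 1 != 0 by rewrite subr_eq0.
elim: m => [|m IH]; first by rewrite big_nil expr0 invr1 subrr mulr0 !mul0r.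
rewrite big_nat_recr //= IH exprS invfM.
by field; rewrite x10 expf_neq0.
Qed.

Theorem corollary4p12 (F : finFieldType) (q n k d delta : nat)
    (C : {vspace 'rV[F]_n})
    (hq : #|F| = q)
    (hn : (0 < n)%N)
    (hk : (\dim C)%VS = k)
    (hd : min_distance (codewords C) = d)
    (hdelta : diameter (codewords C) = delta)
    (hdual : (2 <= min_distance (dual_code (codewords C)))%N) :
  (n%:R <= d%:R
           + q%:R * (1 - q%:R ^- (k - 1)) / (q%:R - 1) * delta%:R :> rat)
  /\ n%:Z <= d%:Z
             + Num.floor (\sum_(0 <= i < k - 1) delta%:R / q%:R ^+ i : rat).
Proof.
(* The dual condition at one coordinate yields a nonzero codeword, so d is an attained weight and
   not the default [n.+1]. *)
have [c [cC c0 wc]] : exists c, [/\ c \in codewords C, c != 0 & hamming_weight c = d].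
  rewrite -hd; have [g gC gi] := dual_gt1_coord (Ordinal hn) hdual.
  apply: (@min_distance_attained _ _ _ g); first by rewrite inE.
  by apply/eqP => g0; move/eqP: gi; rewrite g0 mxE eq_sym oner_eq0.
have {}cC : c \in C by rewrite inE in cC.
have k_gt0 : (0 < k)%N.
  by rewrite -hk lt0n dimv_eq0; apply: contra c0 => /eqP C0; rewrite C0 memv0 in cC.
have q_gt1 : (1 < q)%N by rewrite -hq finNzRing_gt1.
have qR1 : 1 < q%:R :> rat by rewrite ltr1n.
have q0 : q%:R != 0 :> rat by rewrite pnatr_eq0 -lt0n ltnW.
have d_le_n : (d <= n)%N by rewrite -wc hamming_weight_le.
have sumE := @geometric_sumV rat q%:R delta%:R (k - 1) q0 (negbT (gt_eqF qR1)).
have bound : n%:R <= d%:R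
    + q%:R * (1 - q%:R ^- (k - 1)) / (q%:R - 1) * delta%:R :> rat.
  have := length_sub_weight_le hdual cC c0; rewrite wc hq hk hdelta.
  (* From here on [k] stands for the dimension minus 1, so no truncated exponent remains. *)
  case: k k_gt0 {hk sumE} => // k _; rewrite subSS subn0 expnS.
  have q_le : (q <= q * q ^ k)%N by rewrite leq_pmulr // expn_gt0 ltnW.
  rewrite -(ler_nat rat) !natrM !natrB ?natrM ?natrX //; last exact: ltnW.
  have y_gt0 : 0 < q%:R ^+ k :> rat by rewrite exprn_gt0 // (lt_trans ltr01).
  (* With q and its power abstracted as [Q] and [y], it remains to divide by (Q - 1) Q y > 0. *)
  move: (q%:R : rat) (q%:R ^+ k) qR1 y_gt0 => Q y Q_gt1 y_gt0 le_nat.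
  have Q_gt0 : 0 < Q := lt_trans ltr01 Q_gt1.
  have Qy_gt0 : 0 < (Q - 1) * (Q * y) by rewrite !mulr_gt0 ?subr_gt0.
  rewrite -lerBlDl -(ler_pM2r Qy_gt0); apply: le_trans le_nat _.
  by rewrite le_eqVlt; apply/predU1l; field; rewrite !gt_eqF ?subr_gt0.
(* As n - d is an integer, it is below the floor as soon as it is below the sum. *)
split=> //; by rewrite -lerBlDl floor_ge_int sumE rmorphB lerBlDl.
Qed.
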